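(* Let $\Gamma$ be a (non-empty) sequent. If $\vdash\Gamma$ is provable in $\mathsf{LK1}$, then there is a sequent $\Gamma'$ not containing any occurrence of $\mathsf f$ such that $\vdash\Gamma'$ is provable in $\mathsf{MLL1^X}$ and there is a derivation from $\bigvee\Gamma'$ to $\bigvee\Gamma$ using only the rules $\{\mathsf w,\mathsf c,\equiv\}$.
   Context: Formulas: terms $t::=x\mid f(t_1,\dots,t_n)$; atoms $a::=\mathsf t\mid\mathsf f\mid p(\vec t)\mid\bar p(\vec t)$ (each predicate $p$ has a dual $\bar p$, $\bar{\bar p}=p$); formulas $A::=a\mid A\wedge A\mid A\vee A\mid\exists x.A\mid\forall x.A$, negation $\bar{\mathsf t}=\mathsf f$, $\overline{p(\vec t)}=\bar p(\vec t)$, $\overline{\bar p(\vec t)}=p(\vec t)$. A sequent is a finite multiset of formulas; for $\Gamma=A_1,\dots,A_n$, $\bigvee\Gamma=A_1\vee\dots\vee A_n$. $\mathsf{LK1}$ has rules: $\mathsf{ax}$: $\vdash a,\bar a$; $\vee$: from $\vdash\Gamma,A,B$ infer $\vdash\Gamma,A\vee B$; $\wedge$: from $\vdash\Gamma,A$ and $\vdash B,\Delta$ infer $\vdash\Gamma,A\wedge B,\Delta$; $\mathsf t$: $\vdash\mathsf t$; $\mathsf f$: from $\vdash\Gamma$ infer $\vdash\Gamma,\mathsf f$; $\mathsf{mix}$: from $\vdash\Gamma$ and $\vdash\Delta$ infer $\vdash\Gamma,\Delta$; $\exists$: from $\vdash\Gamma,A[x/t]$ infer $\vdash\Gamma,\exists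 x.A$; $\forall$: from $\vdash\Gamma,A$ infer $\vdash\Gamma,\forall x.A$ if $x$ not free in $\Gamma$; $\mathsf{ctr}$: from $\vdash\Gamma,A,A$ infer $\vdash\Gamma,A$; $\mathsf{wk}$: from $\vdash\Gamma$ infer $\vdash\Gamma,A$. $\mathsf{MLL1^X}$ is $\mathsf{LK1}$ without $\mathsf{ctr}$ and $\mathsf{wk}$. $\equiv$ is the smallest congruence on formulas with $\wedge,\vee$ commutative and associative, $\forall x\forall y.A\equiv\forall y\forall x.A$, $\exists x\exists y.A\equiv\exists y\exists x.A$, $\forall x.(A\vee B)\equiv(\forall x.A)\vee B$ and $\exists x.(A\wedge B)\equiv(\exists x.A)\wedge B$ for $x$ not free in $B$. A context $S\{\ \}$ is a formula with one hole in place of an atom. Deep rules (premise $\Rightarrow$ conclusion in any context): $\mathsf w$: $S\{A\}\Rightarrow S\{A\vee B\}$; $\mathsf c$: $S\{A\vee A\}\Rightarrow S\{A\}$; $\equiv$: $S\{B\}\Rightarrow S\{A\}$ if $A\equiv B$. A derivation from $B$ to $A$ is a finite sequence of formulas from $B$ to $A$, each step a rule instance. *)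

(* Defs.v *)
(* First-order formulas in negation normal form, the sequent calculi LK1 and
   MLL1^X, and deep inference derivations in {w, c, equiv}.

   Formulas are taken up to renaming of bound variables.  This quotient is
   realised by de Bruijn indices, but the constructors [Ex] and [All] are only
   used to define the substitution, the free variables and the usual binders
   "exists x. A" and "forall x. A" ([ex x A] and [all_ x A] below); all rules
   are stated with these named binders. *)
From mathcomp Require Import all_boot.
From Stdlib Require Import Permutation Relation_Operators.

Set Implicit Arguments.
Unset Strict Implicit.
Unset Printing Implicit Defensive.

Record signature := Signature {
  fsym : Type;
  fsym_arity : fsym -> nat;
  psym : Type;
  psym_arity : psym -> nat
}.

Section Syntax.
Variable Sg : signature.

Inductive term :=
| Var of nat
| App (f : fsym Sg) (ts : {ffun 'I_(fsym_arity f) -> term}).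

(* [Lit true p ts] is p(ts) and [Lit false p ts] is its dual. *)
Inductive atom :=
| Tt
| Ff
| Lit (b : bool) (p : psym Sg) (ts : {ffun 'I_(psym_arity p) -> term}).

Inductive formula :=
| Atom of atom
| And of formula & formula
| Or of formula & formula
| Ex of formula
| All of formula.

Definition dual (a : atom) : atom :=
  match a with
  | Tt => Ff
  | Ff => Tt
  | Lit b p ts => Lit (~~ b) ts
  end.

Fixpoint tsub (s : nat -> term) (t : term) : term :=
  match t with
  | Var x => s x
  | App f ts => App [ffun i => tsub s (ts i)]
  end.

Definition asub (s : nat -> term) (a : atom) : atom :=
  match a with
  | Tt => Tt
  | Ff => Ff
  | Lit b p ts => Lit b [ffun i => tsub s (ts i)]
  end.

Definition up (s : nat -> term) (x : nat) : term :=
  if x is y.+1 then tsub (fun z => Var z.+1) (s y) else Var 0.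

Fixpoint fsub (s : nat -> term) (A : formula) : formula :=
  match A with
  | Atom a => Atom (asub s a)
  | And B C => And (fsub s B) (fsub s C)
  | Or B C => Or (fsub s B) (fsub s C)
  | Ex B => Ex (fsub (up s) B)
  | All B => All (fsub (up s) B)
  end.

(* A[x/t], capture-avoiding *)
Definition subst (A : formula) (x : nat) (t : term) : formula :=
  fsub (fun y => if y == x then t else Var y) A.

Fixpoint tfree (x : nat) (t : term) : Prop :=
  match t with
  | Var y => x = y
  | App f ts => exists i, tfree x (ts i)
  end.

Definition afree (x : nat) (a : atom) : Prop :=
  match a with
  | Tt | Ff => False
  | Lit b p ts => exists i, tfree x (ts i)
  end.

Fixpoint free (x : nat) (A : formula) : Prop :=
  match A with
  | Atom a => afree x a
  | And B C | Or B C => free x B \/ free x C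
  | Ex B | All B => free x.+1 B
  end.

(* Turns the free variable [x] of [A] into the de Bruijn index bound by a
   quantifier put in front of the result. *)
Definition bind (x : nat) (A : formula) : formula :=
  fsub (fun y => if y == x then Var 0 else Var y.+1) A.

Definition ex (x : nat) (A : formula) : formula := Ex (bind x A).
Definition all_ (x : nat) (A : formula) : formula := All (bind x A).

Fixpoint has_f (A : formula) : bool :=
  match A with
  | Atom Ff => true
  | Atom _ => false
  | And B C | Or B C => has_f B || has_f C
  | Ex B | All B => has_f B
  end.

(* Finite multisets are lists up to permutation: see the rule [Exch]. *)
Definition sequent := seq formula.

(* A1 \/ (A2 \/ ... \/ An); the value on the empty list is irrelevant, since
   no calculus below proves the empty sequent. *)
Fixpoint bigor (G : sequent) : formula :=
  match G with
  | [::] => Atom Ff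
  | [:: A] => A
  | A :: G' => Or A (bigor G')
  end.

(* [structural] tells whether contraction and weakening are available. *)
Inductive provable (structural : bool) : sequent -> Prop :=
| Exch G D : Permutation G D -> provable structural G -> provable structural D
| Ax a : provable structural [:: Atom a; Atom (dual a)]
| OrR A B G :
    provable structural [:: A, B & G] -> provable structural (Or A B :: G)
| AndR A B G D :
    provable structural (A :: G) -> provable structural (B :: D) ->
    provable structural (And A B :: G ++ D)
| TtR : provable structural [:: Atom Tt]
| FfR G : provable structural G -> provable structural (Atom Ff :: G)
| Mix G D :
    provable structural G -> provable structural D ->
    provable structural (G ++ D)
| ExR x t A G :
    provable structural (subst A x t :: G) -> provable structural (ex x A :: G)
| AllR x A G :
    (forall B, List.In B G -> ~ free x B) ->
    provable structural (A :: G) -> provable structural (all_ x A :: G)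
| Ctr A G :
    structural ->
    provable structural [:: A, A & G] -> provable structural (A :: G)
| Wk A G :
    structural -> provable structural G -> provable structural (A :: G).

Definition LK1 : sequent -> Prop := provable true.
Definition MLL1X : sequent -> Prop := provable false.

Inductive equiv : formula -> formula -> Prop :=
| EqRefl A : equiv A A
| EqSym A B : equiv A B -> equiv B A
| EqTrans A B C : equiv A B -> equiv B C -> equiv A C
| EqAnd A A' B B' : equiv A A' -> equiv B B' -> equiv (And A B) (And A' B')
| EqOr A A' B B' : equiv A A' -> equiv B B' -> equiv (Or A B) (Or A' B')
| EqEx x A A' : equiv A A' -> equiv (ex x A) (ex x A')
| EqAll x A A' : equiv A A' -> equiv (all_ x A) (all_ x A')
| AndC A B : equiv (And A B) (And B A)
| OrC A B : equiv (Or A B) (Or B A)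
| AndA A B C : equiv (And A (And B C)) (And (And A B) C)
| OrA A B C : equiv (Or A (Or B C)) (Or (Or A B) C)
| AllAll x y A : equiv (all_ x (all_ y A)) (all_ y (all_ x A))
| ExEx x y A : equiv (ex x (ex y A)) (ex y (ex x A))
| AllOr x A B : ~ free x B -> equiv (all_ x (Or A B)) (Or (all_ x A) B)
| ExAnd x A B : ~ free x B -> equiv (ex x (And A B)) (And (ex x A) B).

Inductive context :=
| Hole
| CAndL of context & formula
| CAndR of formula & context
| COrL of context & formula
| COrR of formula & context
| CEx of nat & context
| CAll of nat & context.

(* S{A}: the quantifiers of S may bind free variables of A. *)
Fixpoint plug (S : context) (A : formula) : formula :=
  match S with
  | Hole => A
  | CAndL S' B => And (plug S' A) B
  | CAndR B S' => And B (plug S' A)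
  | COrL S' B => Or (plug S' A) B
  | COrR B S' => Or B (plug S' A)
  | CEx x S' => ex x (plug S' A)
  | CAll x S' => all_ x (plug S' A)
  end.

(* [step B A]: B is the premise and A the conclusion. *)
Inductive step : formula -> formula -> Prop :=
| StepW S A B : step (plug S A) (plug S (Or A B))
| StepC S A : step (plug S (Or A A)) (plug S A)
| StepEq S A B : equiv A B -> step (plug S B) (plug S A).

Definition derivation : formula -> formula -> Prop :=
  clos_refl_trans_1n formula step.

End Syntax.

(* Main.v *)
(* Contractions and weakenings are pushed to the bottom of the proof.  By
   induction on the LK1 proof of G one builds an f-free sequent provable in
   MLL1^X, each formula of which expands some formula of G: an expansion of A
   is obtained from A by deleting disjuncts and duplicating subformulas, read
   bottom-up.  The multiplicative rules for "and", "exists" and "forall" need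
   a single expansion of their principal formula, so all the expansions of A
   are first joined into one disjunction, which is again an expansion of A.
   If A is not expanded at all, the premise already proves the conclusion.
   For "exists", an expansion of A[x/t] is always an instance [x/t] of an
   expansion of A; for "forall", expansions have no new free variables. *)
Require Import Defs.
From mathcomp Require Import all_boot.
From Stdlib Require Import Permutation Relation_Operators.

Set Implicit Arguments.
Unset Strict Implicit.
Unset Printing Implicit Defensive.

Section Expansion.
Variable Sg : signature.
Implicit Types (t : term Sg) (A B C : formula Sg) (G D K L : sequent Sg).
Implicit Types s r : nat -> term Sg.

(* The automatically generated principle has no hypothesis for subterms. *)
Lemma term_ind_arg (P : term Sg -> Prop) :
  (forall x, P (Var Sg x)) ->
  (forall f (ts : {ffun 'I_(fsym_arity f) -> term Sg}),
     (forall i, P (ts i)) -> P (App ts)) ->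
  forall t, P t.
Proof.
move=> Pvar Papp; fix IH 1 => -[x|f ts]; first exact: Pvar.
by apply: Papp => i; apply: IH.
Qed.

(** * Algebra of simultaneous substitution *)

Lemma tsub_ext s r t :
  (forall x, tfree x t -> s x = r x) -> tsub s t = tsub r t.
Proof.
elim/term_ind_arg: t => [x|f ts IH] /= eq_sr; first exact: eq_sr.
congr App; apply/ffunP=> i; rewrite !ffunE; apply: IH => x x_i.
by apply: eq_sr; exists i.
Qed.

Lemma tsub_comp s r t : tsub s (tsub r t) = tsub (fun x => tsub s (r x)) t.
Proof.
elim/term_ind_arg: t => [x|f ts IH] //=.
by congr App; apply/ffunP=> i; rewrite !ffunE IH.
Qed.

Lemma tsub_id t : tsub (@Var Sg) t = t.
Proof.
elim/term_ind_arg: t => [x|f ts IH] //=.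
by congr App; apply/ffunP=> i; rewrite !ffunE IH.
Qed.

Lemma up_comp s r x : tsub (up s) (up r x) = up (fun y => tsub s (r y)) x.
Proof. by case: x => [|x] //=; rewrite !tsub_comp. Qed.

(** Pointwise agreement stands in for functional extensionality, and its restriction to free
    variables is what lets [bind_open] exploit freshness. *)
Lemma fsub_ext s r A :
  (forall x, free x A -> s x = r x) -> fsub s A = fsub r A.
Proof.
have up_ext s' r' B : (forall x, free x.+1 B -> s' x = r' x) ->
    forall x, free x B -> up s' x = up r' x.
  by move=> eq_sr [|x] //= /eq_sr ->.
elim: A s r => [[||b p ts]|A IHA B IHB|A IHA B IHB|A IHA|A IHA] s r //= eq_sr.
- congr (Atom (Lit _ _)); apply/ffunP=> i; rewrite !ffunE.
  by apply: tsub_ext => x x_i; apply: eq_sr; exists i.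
- by rewrite (IHA s r) ?(IHB s r) // => x x_free; apply: eq_sr; auto.
- by rewrite (IHA s r) ?(IHB s r) // => x x_free; apply: eq_sr; auto.
- by congr Ex; apply/IHA/up_ext.
- by congr All; apply/IHA/up_ext.
Qed.

Lemma fsub_comp s r A : fsub s (fsub r A) = fsub (fun x => tsub s (r x)) A.
Proof.
elim: A s r => [[||b p ts]|A IHA B IHB|A IHA B IHB|A IHA|A IHA] s r //=.
- congr (Atom (Lit _ _)); apply/ffunP=> i; rewrite !ffunE; exact: tsub_comp.
- by rewrite IHA IHB.
- by rewrite IHA IHB.
- by rewrite IHA; congr Ex; apply: fsub_ext => x _; apply: up_comp.
- by rewrite IHA; congr All; apply: fsub_ext => x _; apply: up_comp.
Qed.

Lemma fsub_id A : fsub (@Var Sg) A = A.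
Proof.
have up_id B : fsub (up (@Var Sg)) B = fsub (@Var Sg) B.
  by apply: fsub_ext => -[].
elim: A => [[||b p ts]|A IHA B IHB|A IHA B IHB|A IHA|A IHA] //=.
- by congr (Atom (Lit _ _)); apply/ffunP=> i; rewrite !ffunE tsub_id.
- by rewrite IHA IHB.
- by rewrite IHA IHB.
- by rewrite up_id IHA.
- by rewrite up_id IHA.
Qed.

Lemma has_f_fsub s A : has_f (fsub s A) = has_f A.
Proof.
by elim: A s => [[]|A IHA B IHB|A IHA B IHB|A IHA|A IHA] s //=;
  rewrite IHA ?IHB.
Qed.

(** * Fresh names for bound variables *)

Lemma ord_bound n (Q : 'I_n -> nat -> Prop) :
  (forall i, exists N, forall x, N <= x -> ~ Q i x) ->
  exists N, forall x, N <= x -> ~ exists i, Q i x.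
Proof.
elim: n Q => [|n IHn] Q bnd; first by exists 0 => x _ [[]].
have [N ltN] := IHn (fun i => Q (lift ord0 i)) (fun i => bnd (lift ord0 i)).
have [M ltM] := bnd ord0; exists (maxn M N) => x; rewrite geq_max.
case/andP=> /ltM Q0 /ltN QS [i]; case: (unliftP ord0 i) => [j|] -> // Qj.
by apply: QS; exists j.
Qed.

Lemma free_bound A : exists N, forall x, N <= x -> ~ free x A.
Proof.
have tfree_bound t : exists N, forall x, N <= x -> ~ tfree x t.
  elim/term_ind_arg: t => [y|f ts IH] /=; last exact: ord_bound.
  by exists y.+1 => x + x_y; rewrite x_y ltnn.
have bound2 (P Q : nat -> Prop) : (exists N, forall x, N <= x -> ~ P x) ->
    (exists N, forall x, N <= x -> ~ Q x) ->
    exists N, forall x, N <= x -> ~ (P x \/ Q x).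
  move=> [M ltM] [N ltN]; exists (maxn M N) => x; rewrite geq_max.
  by case/andP=> /ltM Px /ltN Qx [].
elim: A => [[||b p ts]|A IHA B IHB|A IHA B IHB|A [N IHA]|A [N IHA]] /=;
  try by [exists 0 => ? _ []|apply: bound2|exists N => x /leqW/IHA].
by apply: ord_bound => i; apply: tfree_bound.
Qed.

Definition open x : nat -> term Sg :=
  fun n => if n is m.+1 then Var Sg m else Var Sg x.

(** Under a quantifier the name [x] is the index [x.+1]. If it occurred in [A], [bind x] would
    capture it along with the index opened by [open x]. *)
Lemma bind_open x A : ~ free x.+1 A -> bind x (fsub (open x) A) = A.
Proof.
move=> x_fresh; rewrite /bind fsub_comp -[RHS]fsub_id; apply: fsub_ext.
case=> [|y] /= y_free; first by rewrite eqxx.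
by case: eqP => // y_x; case: x_fresh; rewrite -y_x.
Qed.

(** One name serves both formulas, so that a single context [CEx x] or [CAll x] fits both ends of a
    derivation. *)
Lemma fresh_binder A B :
  exists x, bind x (fsub (open x) A) = A /\ bind x (fsub (open x) B) = B.
Proof.
have [N freshN] := free_bound (And A B); exists N.
have := freshN N.+1 (leqnSn N) => /= fresh.
by split; apply: bind_open; auto.
Qed.

(** * Expansions of formulas *)

Inductive expands : formula Sg -> formula Sg -> Prop :=
| exp_atom a : expands (Atom a) (Atom a)
| exp_and A' A B' B :
    expands A' A -> expands B' B -> expands (And A' B') (And A B)
| exp_orl A' A B : expands A' A -> expands A' (Or A B)
| exp_orr B' A B : expands B' B -> expands B' (Or A B)
| exp_ex A' A : expands A' A -> expands (Ex A') (Ex A)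
| exp_all A' A : expands A' A -> expands (All A') (All A)
| exp_dup A1 A2 A : expands A1 A -> expands A2 A -> expands (Or A1 A2) A.

Lemma expands_fsub s A' A : expands A' A -> expands (fsub s A') (fsub s A).
Proof.
by move=> e; elim: e s => * /=; constructor; auto.
Qed.

Lemma expands_free x A' A : expands A' A -> free x A' -> free x A.
Proof.
move=> e; elim: e x => {A' A} /=; try by auto.
- by move=> A' A B' B _ IHA _ IHB x [/IHA|/IHB]; auto.
- by move=> A1 A2 A _ IH1 _ IH2 x [/IH1|/IH2].
Qed.

(** Substitution changes only the inside of atoms, while an expansion acts on the connectives and
    copies atoms whole. Both copies made by [exp_dup] lift separately along the same [s]. *)
Lemma expands_lift s A' A :
  expands A' (fsub s A) -> exists2 A'', fsub s A'' = A' & expands A'' A.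
Proof.
(* The index [fsub s A] becomes a variable, so that the induction leaves [s] and [A] free; [s] turns
   into [up s] below a quantifier. *)
move=> e; have [C eqC] : exists C, C = fsub s A by exists (fsub s A).
rewrite -eqC in e; elim: e s A eqC => {A' C}.
- move=> a s [b|||| ] //= [->]; exists (Atom b) => //; exact: exp_atom.
- move=> A' A B' B _ IHA _ IHB s [|A0 B0| | |] //= [/IHA[A1 <- eA] /IHB[B1 <- eB]].
  by exists (And A1 B1) => //; apply: exp_and.
- move=> A' A B _ IHA s [| |A0 B0| |] //= [/IHA[A1 <- eA] _].
  by exists A1 => //; apply: exp_orl.
- move=> B' A B _ IHB s [| |A0 B0| |] //= [_ /IHB[B1 <- eB]].
  by exists B1 => //; apply: exp_orr.
- move=> A' A _ IHA s [| | |A0|] //= [/IHA[A1 <- eA]].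
  by exists (Ex A1) => //; apply: exp_ex.
- move=> A' A _ IHA s [| | | |A0] //= [/IHA[A1 <- eA]].
  by exists (All A1) => //; apply: exp_all.
- move=> A1 A2 A _ IH1 _ IH2 s A0 eqA.
  have [B1 <- e1] := IH1 _ _ eqA; have [B2 <- e2] := IH2 _ _ eqA.
  by exists (Or B1 B2) => //; apply: exp_dup.
Qed.

(** * Derivations with weakening, contraction and equivalence *)

Lemma derivation_trans B A C :
  derivation A B -> derivation B C -> derivation A C.
Proof.
by elim=> // {}A B' B'' AB' _ IH /IH; apply: rt1n_trans.
Qed.

Lemma derivation_step A B : step A B -> derivation A B.
Proof. by move=> AB; apply: rt1n_trans AB (rt1n_refl _ _ _). Qed.

Lemma plug_comp (S T : context Sg) :
  exists U, forall C, plug S (plug T C) = plug U C.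
Proof.
elim: S => [|S [U plugE] A|A S [U plugE]|S [U plugE] A|A S [U plugE]
           |x S [U plugE]|x S [U plugE]].
- by exists T.
- by exists (CAndL U A) => C /=; rewrite plugE.
- by exists (CAndR A U) => C /=; rewrite plugE.
- by exists (COrL U A) => C /=; rewrite plugE.
- by exists (COrR A U) => C /=; rewrite plugE.
- by exists (CEx x U) => C /=; rewrite plugE.
- by exists (CAll x U) => C /=; rewrite plugE.
Qed.

Lemma derivation_plug S A B :
  derivation A B -> derivation (plug S A) (plug S B).
Proof.
elim=> [C|C C' C'' CC' _]; first exact: rt1n_refl.
apply: rt1n_trans; case: CC' => T => [D E|D|D E DE];
  by have [U plugE] := plug_comp S T; rewrite !plugE; constructor.
Qed.

Lemma derivation_wkl A B : derivation A (Or A B).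
Proof. exact/derivation_step/(StepW (Hole Sg)). Qed.

Lemma derivation_wkr A B : derivation B (Or A B).
Proof.
(* [StepW] adds disjuncts on the right only; commutativity then swaps the two. *)
apply: derivation_trans (derivation_wkl B A) _.
by apply/derivation_step/(StepEq (Hole Sg))/OrC.
Qed.

(** Each disjunct is turned into [C] in place, then one contraction joins the two copies. *)
Lemma derivation_merge A B C :
  derivation A C -> derivation B C -> derivation (Or A B) C.
Proof.
move=> AC BC; apply: derivation_trans (derivation_step (StepC (Hole Sg) C)).
apply: derivation_trans (derivation_plug (COrL (Hole Sg) B) AC) _.
exact: (derivation_plug (COrR C (Hole Sg)) BC).
Qed.

(* The substitution is general because below a quantifier the bound index has
   to be instantiated with a fresh name: the rules only know named binders. *)
Lemma expands_derivation s A' A :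
  expands A' A -> derivation (fsub s A') (fsub s A).
Proof.
move=> e; elim: e s => {A' A} /=.
- by move=> a s; apply: rt1n_refl.
- move=> A' A B' B _ IHA _ IHB s.
  apply: derivation_trans (derivation_plug (CAndL (Hole Sg) _) (IHA s)) _.
  exact: (derivation_plug (CAndR _ (Hole Sg)) (IHB s)).
- by move=> A' A B _ IHA s; apply: derivation_trans (IHA s) (derivation_wkl _ _).
- by move=> B' A B _ IHB s; apply: derivation_trans (IHB s) (derivation_wkr _ _).
- move=> A' A _ IHA s.
  have [x [<- <-]] := fresh_binder (fsub (up s) A') (fsub (up s) A).
  by rewrite !fsub_comp; apply: (derivation_plug (CEx x (Hole Sg)) (IHA _)).
- move=> A' A _ IHA s.
  have [x [<- <-]] := fresh_binder (fsub (up s) A') (fsub (up s) A).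
  by rewrite !fsub_comp; apply: (derivation_plug (CAll x (Hole Sg)) (IHA _)).
- by move=> A1 A2 A _ IH1 _ IH2 s; apply: derivation_merge.
Qed.

Lemma derivation_bigor_in A G : List.In A G -> derivation A (bigor G).
Proof.
elim: G => //= B [|C G] IHG [<-|AG] //; first exact: rt1n_refl.
  exact: derivation_wkl.
by apply: derivation_trans (IHG AG) (derivation_wkr _ _).
Qed.

(** The empty list is excluded because its [bigor] is the default [Atom Ff]. *)
Lemma derivation_bigor_merge G C :
  G <> [::] -> (forall A, List.In A G -> derivation A C) ->
  derivation (bigor G) C.
Proof.
elim: G => //= A [|B G] IHG _ GC; first by apply: GC; left.
apply: derivation_merge; first by apply: GC; left.
by apply: IHG => // A' inA'; apply: GC; right.
Qed.

(** All rules but [Exch] and [Mix] display a formula in their conclusion. *)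
Lemma provable_nonempty b G : provable b G -> G <> [::].
Proof.
elim=> {G} // [G D GD _ nG D0|[|A G] D] //.
by apply: nG; apply: Permutation_nil; apply: Permutation_sym; rewrite -D0.
Qed.

(** * Expansions of sequents and the induction on proofs *)

Definition exp_f_free A' A := ~~ has_f A' /\ expands A' A.

(** Membership without counting: a formula of [G] may have several expansions in [G'] or none, which
    absorbs contraction and weakening. *)
Definition exp_seq G' G :=
  forall A', List.In A' G' -> exists2 A, List.In A G & exp_f_free A' A.

Definition expandable G := exists2 G', MLL1X G' & exp_seq G' G.

Lemma exp_seq_sub G' G D :
  (forall A, List.In A G -> List.In A D) -> exp_seq G' G -> exp_seq G' D.
Proof. by move=> GD eG A' /eG[A /GD AD e]; exists A. Qed.

(** Settles [Exch], [FfR], [Ctr] and [Wk], and the logical rules whose active formula has no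
    expansion. *)
Lemma expandable_sub G D :
  (forall A, List.In A G -> List.In A D) -> expandable G -> expandable D.
Proof. by move=> GD [G' pG' /(exp_seq_sub GD) eG']; exists G'. Qed.

Lemma exp_seq_cons A' G' A G :
  exp_f_free A' A -> exp_seq G' G -> exp_seq (A' :: G') (A :: G).
Proof.
move=> eA eG B' [<-|/eG[B BG eB]]; first by exists A => //; left.
by exists B => //; right.
Qed.

Lemma exp_seq_cat G' D' G D :
  exp_seq G' G -> exp_seq D' D -> exp_seq (G' ++ D') (G ++ D).
Proof.
move=> eG eD A' /(@List.in_app_or _ G' D')[/eG|/eD] [A inA e];
  by exists A => //; apply: (@List.in_or_app _ G D); auto.
Qed.

Lemma exp_seq_partition G' A G : exp_seq G' (A :: G) ->
  exists L K, [/\ Permutation G' (L ++ K),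
    forall B, List.In B L -> exp_f_free B A & exp_seq K G].
Proof.
elim: G' => [|B G' IHG] eG'; first by exists [::], [::]; split=> // B [].
have [|L [K [permG eL eK]]] := IHG; first by move=> C CG; apply: eG'; right.
case: (eG' B) => [|C [<- eB|CG eB]]; first by left.
  exists (B :: L), K; split=> // [|D [<-|/eL]] //.
  exact: perm_skip.
exists L, (B :: K); split=> // [|D [<-|/eK] //]; last by exists C.
exact: Permutation_cons_app.
Qed.

Lemma provable_bigor b L K :
  L <> [::] -> provable b (L ++ K) -> provable b (bigor L :: K).
Proof.
elim: L K => // A [|B L] IHL K _ pLK //.
(* The head [A] joins the side formulas while the induction hypothesis folds the tail. *)
apply: OrR; apply: Exch (perm_swap _ _ _) _; apply: IHL => //.
exact: Exch (Permutation_middle (B :: L) K A) pLK.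
Qed.

Lemma exp_f_free_bigor L A :
  L <> [::] -> (forall B, List.In B L -> exp_f_free B A) ->
  exp_f_free (bigor L) A.
Proof.
elim: L => // B [|C L] IHL _ eL; first by apply: eL; left.
have [fB eB] : exp_f_free B A by apply: eL; left.
have [||fL eCL] := IHL => //; first by move=> D inD; apply: eL; right.
split; last exact: exp_dup.
by apply/norP.
Qed.

Lemma expandable_split A G : expandable (A :: G) ->
  expandable G \/
  exists A' G', [/\ MLL1X (A' :: G'), exp_f_free A' A & exp_seq G' G].
Proof.
case=> G' pG' /exp_seq_partition[L [K [permG eL eK]]].
have {permG pG'}pLK := Exch permG pG'.
case: L => [|B L] in eL pLK *; first by left; exists K.
right; exists (bigor (B :: L)), K; split=> //.
  exact: provable_bigor.
exact: exp_f_free_bigor.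
Qed.

Lemma LK1_expandable G : LK1 G -> expandable G.
Proof.
elim=> {G}.
- move=> G D GD _; apply: expandable_sub => A; exact: Permutation_in.
- case=> [||b p ts] /=.
  (* The axiom itself would keep an [Atom Ff]; [TtR] proves the other atom alone. *)
  + exists [:: Atom (Tt Sg)]; first exact: TtR.
    by move=> _ [<-|//]; exists (Atom (Tt Sg)); [left|split; last constructor].
  + exists [:: Atom (Tt Sg)]; first exact: TtR.
    by move=> _ [<-|//]; exists (Atom (Tt Sg)); [right; left|split; last constructor].
  + exists [:: Atom (Lit b ts); Atom (Lit (~~ b) ts)]; first exact: Ax.
    by do 2!(apply: exp_seq_cons; first by split=> //; constructor).
- move=> A B G _ [G' pG' eG']; exists G' => // C' /eG'[C inC [fC eC]].
  case: inC eC => [<-|[<-|inC]] eC; last by exists C; [right|].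
    by exists (Or A B); [left|split=> //; apply: exp_orl].
  by exists (Or A B); [left|split=> //; apply: exp_orr].
- move=> A B G D _ /expandable_split[eG _ _|[A' [G' [pG' [fA eA] eG']]]].
    apply: expandable_sub eG => C CG; right.
    by apply: (@List.in_or_app _ G D); left.
  move=> _ /expandable_split[eD|[B' [D' [pD' [fB eB] eD']]]].
    apply: expandable_sub eD => C CD; right.
    by apply: (@List.in_or_app _ G D); right.
  exists (And A' B' :: G' ++ D'); first exact: AndR.
  apply: exp_seq_cons; last exact: exp_seq_cat.
  by split; [apply/norP|apply: exp_and].
- exists [:: Atom (Tt Sg)]; first exact: TtR.
  by apply: exp_seq_cons; first by split=> //; constructor.
- by move=> G _; apply: expandable_sub => A; right.
- move=> G D _ [G' pG' eG'] _ [D' pD' eD'].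
  by exists (G' ++ D'); [apply: Mix|apply: exp_seq_cat].
- move=> x t A G _ /expandable_split[|[A' [G' [pG' [fA eA] eG']]]].
    by apply: expandable_sub => B; right.
  have [A'' eqA eA''] := expands_lift eA.
  exists (ex x A'' :: G'); first by apply: (@ExR _ _ x t); rewrite /subst eqA.
  apply: exp_seq_cons => //; split; last exact/exp_ex/expands_fsub.
  by rewrite /= has_f_fsub; rewrite -eqA has_f_fsub in fA.
- move=> x A G x_fresh _ /expandable_split[|[A' [G' [pG' [fA eA] eG']]]].
    by apply: expandable_sub => B; right.
  exists (all_ x A' :: G').
    by apply: AllR => // B /eG'[C /x_fresh xC [_ /expands_free eB]] /eB.
  apply: exp_seq_cons => //; split; last exact/exp_all/expands_fsub.
  by rewrite /= has_f_fsub.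
- by move=> A G _ _; apply: expandable_sub => B [<-|//]; left.
- by move=> A G _ _; apply: expandable_sub => B; right.
Qed.

End Expansion.

Theorem theorem7p10 (Sg : signature) (G : sequent Sg) :
  G <> [::] ->
  LK1 G ->
  exists G' : sequent Sg,
    [/\ all (fun A => ~~ has_f A) G',
        MLL1X G' &
        derivation (bigor G') (bigor G)].
Proof.
move=> _ /LK1_expandable[G' pG' eG']; exists G'; split=> //.
  elim: G' {pG'} eG' => //= A G' IHG eG'; apply/andP; split.
    by have [|B _ []] := eG' A; first by left.
  by apply: IHG => B inB; apply: eG'; right.
apply: derivation_bigor_merge (provable_nonempty pG') _ => A' /eG'[A inA [_ eA]].
apply: derivation_trans (derivation_bigor_in inA).
(* The identity substitution specialises the general statement to the formulas themselves. *)
by have := expands_derivation (@Var Sg) eA; rewrite !fsub_id.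
Qed.
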